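(* Let $X_1,\dots,X_n$ be independent random variables with $X_i\sim GM(\alpha_i,\beta,\lambda)$, $i=1,\dots,n$, and let $Y_1,\dots,Y_n$ be independent random variables with $Y_i\sim GM(\alpha_i^*,\beta,\lambda)$, $i=1,\dots,n$ (all parameters positive). Write $\underline\alpha=(\alpha_1,\dots,\alpha_n)$ and $\underline\alpha^*=(\alpha_1^*,\dots,\alpha_n^* )$. If $\underline\alpha\prec^{w}\underline\alpha^*$, then $X_{n:n}\le_{st}Y_{n:n}$.
   Context: Gompertz–Makeham distribution: for $\alpha,\beta,\lambda>0$, $X\sim GM(\alpha,\beta,\lambda)$ means that $X$ has cdf $1-e^{-\lambda x-\frac{\alpha}{\beta}(e^{\beta x}-1)}$ for $x>0$ (and $0$ for $x\le0$). $X_{n:n}=\max(X_1,\dots,X_n)$, and similarly for $Y_{n:n}$. Usual stochastic order: $X\le_{st}Y$ iff $P(X>x)\le P(Y>x)$ for all $x\in\mathbb R$. For $\underline a,\underline b\in\mathbb R^n$ with increasing rearrangements $a_{1:n}\le\cdots\le a_{n:n}$ and $b_{1:n}\le\cdots\le b_{n:n}$, $\underline a$ is weakly supermajorized by $\underline b$, written $\underline a\prec^{w}\underline b$, if $\sum_{i=1}^k a_{i:n}\ge\sum_{i=1}^k b_{i:n}$ for all $k=1,\dots,n$. *)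

(* Defs.v *)
From HB Require Import structures.
From mathcomp Require Import all_boot all_order all_algebra.
From mathcomp Require Import all_classical all_reals all_analysis.
From mathcomp Require Import measurable_realfun.

Set Implicit Arguments.
Unset Strict Implicit.
Unset Printing Implicit Defensive.

Import Order.TTheory GRing.Theory Num.Theory.
Import numFieldNormedType.Exports.

Local Open Scope classical_set_scope.
Local Open Scope ring_scope.

Definition mutually_independent (d : measure_display) (T : measurableType d)
    (R : realType) (P : probability T R) (I : finType)
    (X : I -> {RV P >-> R}) : Prop :=
  forall (J : {set I}) (B : I -> set R),
    (forall i, i \in J -> measurable (B i)) ->
    P (\bigcap_(i in [set` J]) (X i @^-1` B i)) =
      (\prod_(i in J) P (X i @^-1` B i))%E.

Definition GM_cdf (R : realType) (alpha beta lambda x : R) : R :=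
  if 0 < x
  then 1 - expR (- lambda * x - alpha / beta * (expR (beta * x) - 1))
  else 0.

Definition GompertzMakeham (d : measure_display) (T : measurableType d)
    (R : realType) (P : probability T R) (X : {RV P >-> R})
    (alpha beta lambda : R) : Prop :=
  forall x : R, cdf X x = (GM_cdf alpha beta lambda x)%:E.

(* The default value [X ord0 w] of the iterated maximum is itself one of the
   maximized values, so this is the exact maximum, with no sign condition. *)
Definition sample_max (d : measure_display) (T : measurableType d)
    (R : realType) (P : probability T R) (n : nat)
    (X : 'I_n.+1 -> {RV P >-> R}) : T -> R :=
  fun w => \big[Num.max/X ord0 w]_(i < n.+1) X i w.

Lemma measurable_sample_max (d : measure_display) (T : measurableType d)
    (R : realType) (P : probability T R) (n : nat)
    (X : 'I_n.+1 -> {RV P >-> R}) :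
  measurable_fun setT (sample_max X).
Proof.
rewrite /sample_max; elim: (index_enum _) => [|i s IHs].
  rewrite (_ : (fun w => _) = X ord0) //.
  by apply/funext => w; rewrite big_nil.
rewrite (_ : (fun w => _) =
    X i \max (fun w => \big[Num.max/X ord0 w]_(j <- s) X j w)).
  exact: measurable_maxr.
by apply/funext => w; rewrite big_cons.
Qed.

HB.instance Definition _ (d : measure_display) (T : measurableType d)
    (R : realType) (P : probability T R) (n : nat)
    (X : 'I_n.+1 -> {RV P >-> R}) :=
  isMeasurableFun.Build _ _ T R (sample_max X) (measurable_sample_max X).

(* The two variables may live on different probability spaces. *)
Definition st_le (d d' : measure_display) (T : measurableType d)
    (T' : measurableType d') (R : realType)
    (P : probability T R) (Q : probability T' R)
    (X : {RV P >-> R}) (Y : {RV Q >-> R}) : Prop :=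
  forall x : R, (ccdf X x <= ccdf Y x)%E.

(* [increasing_rearrangement a i] is a_{i+1:n}: positions are counted from 0. *)
Definition increasing_rearrangement (R : realType) (n : nat) (a : 'I_n -> R)
    (i : nat) : R :=
  nth 0 (sort <=%O (codom a)) i.

Definition weakly_supermajorized (R : realType) (n : nat) (a b : 'I_n -> R) :
    Prop :=
  forall k : nat, (1 <= k <= n)%N ->
    \sum_(0 <= i < k) increasing_rearrangement b i
      <= \sum_(0 <= i < k) increasing_rearrangement a i.

(* Main.v *)
(* For fixed x > 0, P(X_{n:n} <= x) is the product of the
   h(alpha_i) = 1 - exp(-(lambda x + c alpha_i)), c = (e^{beta x} - 1) / beta.
   The function ln h is increasing and concave, so with w = (ln h)' >= 0
   nonincreasing and both vectors sorted,
     sum (ln h(alpha*_i) - ln h(alpha_i)) <= sum w(alpha_i) (alpha*_i - alpha_i),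
   and Abel summation makes the right-hand side nonpositive under weak
   supermajorization. *)
Require Import Defs.
From HB Require Import structures.
From mathcomp Require Import all_boot all_order all_algebra.
From mathcomp Require Import all_classical all_reals all_analysis.
From mathcomp Require Import ring.

Import Order.TTheory GRing.Theory Num.Theory.

Local Open Scope ring_scope.

(* Abel summation: the bound by [w m] times the full sum is what propagates
   along the induction. *)
Lemma sum_antitone_weights_le {R : realDomainType} {w u : nat -> R} {m : nat} :
    (forall i, (i < m)%N -> w i.+1 <= w i) ->
    (forall k, (1 <= k <= m)%N -> \sum_(0 <= i < k) u i <= 0) ->
  \sum_(0 <= i < m.+1) w i * u i <= w m * \sum_(0 <= i < m.+1) u i.
Proof.
elim: m => [|m IHm] w_anti u_le0; first by rewrite !big_nat1.
rewrite big_nat_recr //= [in leRHS]big_nat_recr //= mulrDr lerD2r.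
apply: le_trans (IHm _ _) _.
- by move=> i im; apply: w_anti; rewrite ltnS ltnW.
- by move=> k /andP[k1 km]; apply: u_le0; rewrite k1 ltnW.
(* The sum of the first [m.+1] terms is nonpositive, so passing from [w m] to the smaller [w m.+1]
   can only increase the product. *)
- by rewrite ler_wnM2r ?u_le0 ?w_anti ?leqnn.
Qed.

Lemma prod_increasing_rearrangement (R : realType) (n : nat) (a : 'I_n -> R)
    (h : R -> R) :
  \prod_(i < n) h (a i) = \prod_(0 <= i < n) h (increasing_rearrangement a i).
Proof.
rewrite -(big_image _ _ a predT h) /=.
rewrite -(perm_big _ (permEl (perm_sort <=%O (codom a)))) /=.
by rewrite (big_nth 0) size_sort size_codom card_ord.
Qed.

Lemma increasing_rearrangement_gt0 (R : realType) (n : nat) (a : 'I_n -> R)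
    (i : nat) :
  (forall j, 0 < a j) -> (i < n)%N -> 0 < increasing_rearrangement a i.
Proof.
move=> a_gt0 lt_in; have : increasing_rearrangement a i \in codom a.
  rewrite -(perm_mem (permEl (perm_sort <=%O _))) mem_nth //.
  by rewrite size_sort size_codom card_ord.
by move=> /codomP[j ->].
Qed.

Lemma increasing_rearrangement_homo (R : realType) (n : nat) (a : 'I_n -> R)
    (i : nat) :
  (i.+1 < n)%N ->
  increasing_rearrangement a i <= increasing_rearrangement a i.+1.
Proof.
move=> lt_in; apply: (sorted_leq_nth le_trans le_refl 0) => //.
- exact/sort_sorted/le_total.
- by rewrite inE size_sort size_codom card_ord ltnW.
- by rewrite inE size_sort size_codom card_ord.
Qed.

(* The tangent-line hypothesis says that [ln h] is concave with supergradient
   [w]; the logarithm is avoided so that no derivative is needed. *)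
Lemma weakly_supermajorized_prod_le {R : realType} {n : nat}
    {a b : 'I_n.+1 -> R} (h w : R -> R) :
    (forall i, 0 < a i) -> (forall i, 0 < b i) ->
    (forall x, 0 < x -> 0 <= h x) ->
    (forall x, 0 < x -> 0 <= w x) ->
    (forall x y, 0 < x -> x <= y -> w y <= w x) ->
    (forall x y, 0 < x -> 0 < y -> h y <= h x * expR (w x * (y - x))) ->
    weakly_supermajorized a b ->
  \prod_i h (b i) <= \prod_i h (a i).
Proof.
move=> a_gt0 b_gt0 h_ge0 w_ge0 w_anti h_tangent ab.
rewrite !prod_increasing_rearrangement.
set A := increasing_rearrangement a; set B := increasing_rearrangement b.
have A_gt0 i : (i < n.+1)%N -> 0 < A i by exact: increasing_rearrangement_gt0.
have B_gt0 i : (i < n.+1)%N -> 0 < B i by exact: increasing_rearrangement_gt0.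
have BA k : (1 <= k <= n.+1)%N -> \sum_(0 <= i < k) (B i - A i) <= 0.
  by move=> /ab; rewrite sumrB subr_le0.
have sum_le0 : \sum_(0 <= i < n.+1) w (A i) * (B i - A i) <= 0.
  apply: le_trans (sum_antitone_weights_le _ _) _.
  - move=> i lt_in; apply: w_anti; first by rewrite A_gt0 // ltnS ltnW.
    exact: increasing_rearrangement_homo.
  - by move=> k /andP[k1 kn]; rewrite BA // k1 ltnW.
  (* The totals are only ordered, not equal, so the sign of the last weight matters here. *)
  - by rewrite mulr_ge0_le0 ?w_ge0 ?A_gt0 ?BA ?leqnn.
apply: (@le_trans _ _
    (\prod_(0 <= i < n.+1) (h (A i) * expR (w (A i) * (B i - A i))))).
  rewrite !big_mkord; apply: ler_prod => i _.
  by rewrite h_ge0 ?h_tangent ?A_gt0 ?B_gt0.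
(* The exponential factors multiply to the exponential of the sum in [sum_le0], hence to at most
   1. *)
rewrite big_split /= -expR_sum ler_piMr ?expR_le1 //.
by rewrite big_mkord prodr_ge0 // => i _; rewrite h_ge0 ?A_gt0.
Qed.

(** The maximum is at most [x] exactly when every [X i] is, so independence applies to the full
    index set with all [B i] equal to []-oo, x]]. *)
Lemma cdf_sample_max (d : measure_display) (T : measurableType d)
    (R : realType) (P : probability T R) (n : nat)
    (X : 'I_n.+1 -> {RV P >-> R}) (x : R) :
  mutually_independent X ->
  cdf (P := P) (sample_max X) x = (\prod_i cdf (X i) x)%E.
Proof.
move=> indep.
have := indep [set: 'I_n.+1]%SET (fun=> `]-oo, x]%classic)
  (fun _ _ => measurable_itv _).
rewrite (eq_bigl predT) => [<-|i]; last by rewrite inE.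
rewrite /cdf /distribution /pushforward /=; congr (P _).
apply/seteqP; split=> w /=.
- by rewrite in_itv /= => /bigmax_leP[_ le_x] i _; rewrite /= in_itv /= le_x.
- move=> X_le; have {}X_le i : X i w <= x.
    by have := X_le i; rewrite /= in_itv /= inE; exact.
  by rewrite in_itv /=; apply/bigmax_leP; split.
Qed.

(** The weight is the derivative of [ln (1 - expR (- (l + c * x)))] in [x]. Bounding the exponential
    on the right below by [1 + t] leaves [1 - expR (- s) * (1 - c * (y - x))], where
    [s = l + c * x]; the same bound applied to [expR (- (c * (y - x)))] concludes. *)
Lemma subr1_expRN_tangent (R : realType) (c l x y : R) : 0 < l + c * x ->
  1 - expR (- (l + c * y)) <=
  (1 - expR (- (l + c * x))) *
    expR (c / (expR (l + c * x) - 1) * (y - x)).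
Proof.
move=> s_gt0; set s := l + c * x in s_gt0 *.
have es_gt1 : 1 < expR s by rewrite expR_gt1.
have h_ge0 : 0 <= 1 - expR (- s) by rewrite subr_ge0 expR_le1 oppr_le0 ltW.
apply: le_trans (ler_wpM2l h_ge0 (expR_ge1Dx _)).
have -> : - (l + c * y) = - s + - (c * (y - x)) by rewrite /s; ring.
rewrite expRD.
have -> : (1 - expR (- s)) * (1 + c / (expR s - 1) * (y - x)) =
    1 - expR (- s) * (1 - c * (y - x)).
  by rewrite expRN; field; rewrite subr_eq0 !gt_eqF // expR_gt0.
by rewrite lerD2l lerN2 ler_wpM2l ?expR_ge0 // expR_ge1Dx.
Qed.

Theorem theorem10 (R : realType) (n : nat)
  (d : measure_display) (T : measurableType d) (P : probability T R)
  (d' : measure_display) (T' : measurableType d') (Q : probability T' R)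
  (X : 'I_n.+1 -> {RV P >-> R}) (Y : 'I_n.+1 -> {RV Q >-> R})
  (alpha alphastar : 'I_n.+1 -> R) (beta lambda : R)
  (beta_gt0 : 0 < beta) (lambda_gt0 : 0 < lambda)
  (alpha_gt0 : forall i, 0 < alpha i)
  (alphastar_gt0 : forall i, 0 < alphastar i)
  (X_indep : mutually_independent X)
  (X_GM : forall i, GompertzMakeham (X i) (alpha i) beta lambda)
  (Y_indep : mutually_independent Y)
  (Y_GM : forall i, GompertzMakeham (Y i) (alphastar i) beta lambda)
  (alpha_maj : weakly_supermajorized alpha alphastar) :
  st_le (P := P) (Q := Q) (sample_max X) (sample_max Y).
Proof.
(* Complementation reverses the order: the product for [Y] must be at most the one for [X]. *)
move=> x; rewrite !ccdf_1_cdf leeB // !cdf_sample_max //.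
under eq_bigr do rewrite Y_GM; under [leRHS]eq_bigr do rewrite X_GM.
rewrite !prodEFin lee_fin /GM_cdf.
(* For [x <= 0] both products have all factors zero and coincide. *)
case: (ltP 0 x) => // x_gt0.
pose c := (expR (beta * x) - 1) / beta; pose l := lambda * x.
have c_gt0 : 0 < c by rewrite divr_gt0 // subr_gt0 expR_gt1 mulr_gt0.
have l_gt0 : 0 < l by rewrite mulr_gt0.
have hE a : - lambda * x - a / beta * (expR (beta * x) - 1) = - (l + c * a).
  by rewrite /l /c; field; rewrite gt_eqF.
under eq_bigr do rewrite hE; under [leRHS]eq_bigr do rewrite hE.
have s_gt0 a : 0 < a -> 0 < l + c * a.
  by move=> a_gt0; rewrite addr_gt0 // mulr_gt0.
apply: (weakly_supermajorized_prod_le (fun a => 1 - expR (- (l + c * a)))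
  (fun a => c / (expR (l + c * a) - 1))) => // [a /s_gt0|a /s_gt0|a b|a b].
- by move=> s0; rewrite subr_ge0 expR_le1 oppr_le0 ltW.
- by move=> s0; rewrite divr_ge0 ?subr_ge0 ?ltW // expR_gt1.
- move=> a_gt0 ab; have b_gt0 := lt_le_trans a_gt0 ab.
  rewrite ler_pM2l // lef_pV2 ?posrE ?subr_gt0 ?expR_gt1 ?s_gt0 //.
  by rewrite lerD2r ler_expR lerD2l ler_pM2l.
- by move=> a_gt0 _; apply: subr1_expRN_tangent; exact: s_gt0.
Qed.
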